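(* Let $\mu,\nu$ be real with $\mu+\nu>0$ and $\mu+1\geq\nu$, and let $b>a>0$. Then the probability distribution on $(0,\infty)$ with probability density function $$\varphi_{\mu,\nu,a,b}(x)=\frac{1}{c_{\mu,\nu,a,b}}\,x^{\nu-1}e^{-bx}I_{\mu}(ax),\qquad x>0,$$ where $$c_{\mu,\nu,a,b}=\frac{\left(a/2\right)^{\mu}}{b^{\mu+\nu}}\,\frac{\Gamma(\mu+\nu)}{\Gamma(\mu+1)}\,{}_2F_1\left(\frac{\mu+\nu}{2},\frac{\mu+\nu+1}{2},\mu+1,\frac{a^2}{b^2}\right),$$ is infinitely divisible.
   Context: $I_\mu$ is the modified Bessel function of the first kind of order $\mu$, $\Gamma$ is the Euler gamma function, and ${}_2F_1(\alpha,\beta,\gamma,x)$ is the Gaussian hypergeometric function with upper parameters $\alpha,\beta$, lower parameter $\gamma$ and argument $x$. The density $\varphi_{\mu,\nu,a,b}$ is defined in general for $\mu+1>0$, $\mu+\nu>0$ and $b>a>0$. A probability distribution $\nu_0$ on $[0,\infty)$ is infinitely divisible if for every $n\in\mathbb{N}$ there is a probability distribution $\nu_n$ on $[0,\infty)$ with $\int_0^\infty e^{-xt}d\nu_0(t)=\left[\int_0^\infty e^{-xt}d\nu_n(t)\right]^n$ for all $x>0$. *)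

(* Defs.v *)
From HB Require Import structures.
From mathcomp Require Import all_boot all_order all_algebra.
From mathcomp Require Import all_classical all_reals all_analysis.

Set Implicit Arguments.
Unset Strict Implicit.
Unset Printing Implicit Defensive.

Import Order.TTheory GRing.Theory Num.Theory.
Import numFieldNormedType.Exports.

Local Open Scope classical_set_scope.
Local Open Scope ring_scope.

(* Euler's integral: this is the gamma function only for 0 < x (for x <= 0 the
   integral diverges and [Rintegral] returns 0). *)
Definition Gamma (R : realType) (x : R) : R :=
  \int[@lebesgue_measure R]_(t in `]0%R, +oo[) (t `^ (x - 1) * expR (- t)).

(* The rising factorial (x)_n = x (x + 1) ... (x + n - 1). *)
Definition pochhammer (R : realType) (x : R) (n : nat) : R :=
  \prod_(i < n) (x + i%:R).

(* Meaningful for `|x| < 1 and gam not a nonpositive integer. *)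
Definition hypergeom2F1 (R : realType) (al be gam x : R) : R :=
  limn (pseries (fun k => pochhammer al k * pochhammer be k
                          / (pochhammer gam k * k`!%:R)) x).

(* I_mu(x) = sum_k (x / 2)^(mu + 2 k) / (k! Gamma(mu + k + 1)), with the factor
   (x / 2)^mu taken out of the sum; meaningful for 0 < x and -1 < mu, where all
   the arguments of Gamma are positive. *)
Definition besselI (R : realType) (mu x : R) : R :=
  (x / 2) `^ mu
  * limn (pseries (fun k => (k`!%:R * Gamma (mu + k%:R + 1))^-1) ((x / 2) ^+ 2)).

Definition norm_const (R : realType) (mu nu a b : R) : R :=
  (a / 2) `^ mu / b `^ (mu + nu) * (Gamma (mu + nu) / Gamma (mu + 1))
  * hypergeom2F1 ((mu + nu) / 2) ((mu + nu + 1) / 2) (mu + 1) (a ^+ 2 / b ^+ 2).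

Definition bessel_pdf (R : realType) (mu nu a b : R) : R -> R :=
  (fun x => (norm_const mu nu a b)^-1
            * (x `^ (nu - 1) * expR (- (b * x)) * besselI mu (a * x)))
  \_ `]0%R, +oo[.

Definition has_density (R : realType)
    (P : probability (measurableTypeR R) R) (f : R -> R) : Prop :=
  forall A : set (measurableTypeR R), measurable A ->
    P A = (\int[@lebesgue_measure R]_(x in A) (f x)%:E)%E.

(* Distributions on [0, +oo[ are represented as probability measures on the
   real line that give [0, +oo[ full mass. *)
Definition supported_nonneg (R : realType)
    (P : probability (measurableTypeR R) R) : Prop :=
  P `[0%R, +oo[%classic = 1%E.

Definition laplace (R : realType)
    (P : probability (measurableTypeR R) R) (x : R) : \bar R :=
  (\int[P]_(t in `[0%R, +oo[) (expR (- (x * t)))%:E)%E.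

Definition infinitely_divisible (R : realType)
    (P : probability (measurableTypeR R) R) : Prop :=
  supported_nonneg P /\
  forall n : nat, (0 < n)%N ->
    exists Q : probability (measurableTypeR R) R,
      supported_nonneg Q /\
      forall x : R, 0 < x -> laplace P x = (laplace Q x ^+ n)%E.

(* Main.v *)
Require Import Defs.
From HB Require Import structures.
From mathcomp Require Import all_boot all_order all_algebra.
From mathcomp Require Import all_classical all_reals all_analysis.
From mathcomp Require Import measurable_realfun ring lra.
Import Order.TTheory GRing.Theory Num.Theory.
Import numFieldNormedType.Exports.
Local Open Scope classical_set_scope.
Local Open Scope ring_scope.

(** Put [z = (a / (b + s))^2].  By the duplication formula the law is a mixture
    of gamma laws with common rate [b] and shapes [mu + nu + 2 k], and its Laplace
    transform at [s] is proportional to [(b + s)^-(mu + nu) F(z)], where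
    [F = 2F1((mu + nu) / 2, (mu + nu + 1) / 2; mu + 1; .)].  Gauss's continued
    fraction has nonnegative coefficients as soon as both upper parameters are at
    most the lower one, i.e. when [nu <= mu + 1].  Hence [z F'(z) / F(z)], and so
    also the formal [n]-th root [H] of [F], has nonnegative coefficients, and the
    gamma mixture with weights read off [H] and shapes [(mu + nu) / n + 2 k] is an
    [n]-th convolution root of the law. *)

Set Implicit Arguments.
Unset Strict Implicit.
Unset Printing Implicit Defensive.

(** * Formal power series and hypergeometric coefficients *)

(** Write [F(a, b; c)] for the hypergeometric series and [theta] for [z d/dz]. The link between the
    continued fraction and [theta F / F] is [theta F = a (F(a + 1, b; c) - F)]: with
    [s = F(a + 1, b; c) / F] the logarithmic derivative is [a (s - 1)], and [s = 1 + (b / c) z r s],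
    where [r = F(a + 1, b + 1; c + 1) / F(a + 1, b; c)] is a ratio of Gauss's type. The continued
    fraction is never formed: each of its ratios solves [q = 1 + k z r q] with [k >= 0] and [r] the
    next ratio, and the factor [z] turns positivity into an induction on the degree. The root [H] is
    likewise the formal solution of [n theta H = H (theta F / F)], so neither zeros of [F] nor
    branches of a root intervene. Returning to functions costs little, because everything is
    nonnegative: values are sums in the extended reals, where the order of summation is free, and
    the coefficients of [H] are at most those of [F], so [H] converges wherever [F] does. *)

Definition fps (R : Type) := nat -> R.

(** Iterating [Phi] on all coefficients at once freezes the one of index [k] after [k.+1] rounds, so
    the starting value [x0] is forgotten. *)
Lemma fps_strong_rec (T : Type) (Phi : nat -> (nat -> T) -> T) (x0 : T) :
  (forall n x y, (forall i, (i < n)%N -> x i = y i) -> Phi n x = Phi n y) ->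
  exists x : fps T, forall n, x n = Phi n x.
Proof.
move=> PhiE; pose s n := iter n (fun x k => Phi k x) (fun=> x0).
have sE m n k : (k < m)%N -> (k < n)%N -> s m k = s n k.
  elim: m n k => [//|m IH] [//|n] k km kn; apply: PhiE => i ik.
  by apply: IH; exact: leq_trans ik _.
exists (fun n => s n.+1 n) => n; apply: PhiE => i ik; exact: sE.
Qed.

(** * The ring of formal power series *)

Section FpsRing.
Variable R : comNzRingType.
Implicit Types x y z : fps R.

(** Only addition is inherited from functions; the product is to be Cauchy's, not the pointwise
    one. *)
HB.instance Definition _ := GRing.Zmodule.copy (fps R) (nat -> R).

Definition fps_one : fps R := fun n => (n == 0%N)%:R.
Definition fps_mul x y : fps R := fun n => \sum_(i < n.+1) x i * y (n - i)%N.

(** A coefficient of a product depends on finitely many coefficients of the factors, so the ring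
    laws can be read off polynomials. *)
Let trunc n x : {poly R} := \poly_(i < n) x i.

Let fps_mul_trunc N n x y : (n < N)%N ->
  fps_mul x y n = (trunc N x * trunc N y)`_n.
Proof.
move=> nN; rewrite coefM; apply: eq_bigr => i _; rewrite !coef_poly.
by rewrite !ifT// (leq_ltn_trans _ nN)// ?leq_subr// -ltnS.
Qed.

Let trunc_mul N n x y : (n < N)%N ->
  (trunc N (fps_mul x y))`_n = (trunc N x * trunc N y)`_n.
Proof. by move=> nN; rewrite coef_poly nN (fps_mul_trunc _ _ nN). Qed.

Let fps_mulC : commutative fps_mul.
Proof.
by move=> x y; apply/funext => n; rewrite !(fps_mul_trunc _ _ (ltnSn n)) mulrC.
Qed.

Let fps_mulA : associative fps_mul.
Proof.
move=> x y z; apply/funext => n; rewrite !(fps_mul_trunc _ _ (ltnSn n)).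
transitivity ((trunc n.+1 x * (trunc n.+1 y * trunc n.+1 z))`_n).
  rewrite coefM [RHS]coefM; apply: eq_bigr => i _.
  by rewrite trunc_mul// ltnS leq_subr.
rewrite mulrA coefM [RHS]coefM; apply: eq_bigr => i _.
by rewrite trunc_mul.
Qed.

Let fps_mul1 : left_id fps_one fps_mul.
Proof.
move=> x; apply/funext => n; rewrite /fps_mul big_ord_recl/= subn0 mul1r.
by rewrite big1 ?addr0// => i _; rewrite mul0r.
Qed.

Let fps_mulDl : left_distributive fps_mul +%R.
Proof.
move=> x y z; apply/funext => n; rewrite -[RHS]/(_ n + _ n) -big_split.
by apply: eq_bigr => i _ /=; exact: mulrDl.
Qed.

Let fps_one_neq0 : fps_one != 0.
Proof. by apply/eqP => /(congr1 (fun x : fps R => x 0%N)) /eqP; rewrite oner_eq0. Qed.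

HB.instance Definition _ := GRing.Zmodule_isComNzRing.Build (fps R)
  fps_mulA fps_mulC fps_mul1 fps_mulDl fps_one_neq0.

Lemma fps_mulE x y n : (x * y) n = \sum_(i < n.+1) x i * y (n - i)%N.
Proof. by []. Qed.

Lemma fps_addE x y n : (x + y) n = x n + y n.
Proof. by []. Qed.

Lemma fps_oppE x n : (- x) n = - x n.
Proof. by []. Qed.

Lemma fps_natmulE x k n : (x *+ k) n = x n *+ k.
Proof. by elim: k => [//|k IH]; rewrite !mulrSr fps_addE IH. Qed.

Lemma fps_oneE n : (1 : fps R) n = (n == 0%N)%:R.
Proof. by []. Qed.

Lemma fps_mul_coef0 x y : (x * y) 0%N = x 0%N * y 0%N.
Proof. by rewrite fps_mulE big_ord_recl big_ord0 addr0. Qed.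

Lemma fps_exp_coef0 x n : (x ^+ n) 0%N = x 0%N ^+ n.
Proof. by elim: n => [//|n IH]; rewrite !exprS fps_mul_coef0 IH. Qed.

(* the monomial [a z^m] *)
Definition fps_mono a m : fps R := fun n => if n == m then a else 0.

Lemma fps_mono_mulE a m x n :
  (fps_mono a m * x) n = if (m <= n)%N then a * x (n - m)%N else 0.
Proof.
rewrite fps_mulE; case: leqP => mn.
  rewrite (bigD1 (Ordinal (mn : (m < n.+1)%N)))//= /fps_mono eqxx.
  rewrite big1 ?addr0// => i; rewrite -val_eqE/= => /negbTE ->.
  by rewrite mul0r.
rewrite big1// => i _; rewrite /fps_mono ifF ?mul0r//.
by apply/negbTE; rewrite neq_ltn (leq_ltn_trans _ mn)// -ltnS.
Qed.

(** Euler's operator [z d/dz]: a derivation which, unlike [d/dz], does not shift the index. *)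
Definition fps_theta x : fps R := fun n => n%:R * x n.

Lemma fps_thetaM x y : fps_theta (x * y) = fps_theta x * y + x * fps_theta y.
Proof.
apply/funext => n; rewrite fps_addE /fps_theta !fps_mulE mulr_sumr -big_split.
apply: eq_bigr => i _ /=; have in' : (i <= n)%N by rewrite -ltnS.
by rewrite -{1}(subnKC in') natrD; ring.
Qed.

Lemma fps_thetaX x n : fps_theta (x ^+ n.+1) = x ^+ n * fps_theta x *+ n.+1.
Proof.
elim: n => [|n IH]; first by rewrite expr0 mul1r expr1.
rewrite exprS fps_thetaM IH exprS -mulr_natr -[RHS]mulr_natr; ring.
Qed.

(** As [y] has constant term 1, degree [n] of the equation yields [q n] from the earlier
    coefficients. Quotients are later used only through this equation, together with the
    cancellation law [fps_mulI]. *)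
Lemma fps_div (x y : fps R) : y 0%N = 1 -> exists q : fps R, q * y = x.
Proof.
move=> y0; have [|q qE] := @fps_strong_rec _
    (fun n q => x n - \sum_(i < n) q i * y (n - i)%N) (0 : R).
  by move=> n q r qr; congr (_ - _); apply: eq_bigr => i _; rewrite qr.
exists q; apply/funext => n.
by rewrite fps_mulE big_ord_recr/= subnn y0 mulr1 addrC {1}qE subrK.
Qed.

Lemma fps_mulI x y z : z 0%N = 1 -> x * z = y * z -> x = y.
Proof.
move=> z0 xyz; apply/funext => n; elim/ltn_ind: n => n IH.
have := congr1 (fun u : fps R => u n) xyz.
rewrite /= !fps_mulE !big_ord_recr/= subnn z0 !mulr1.
have -> : \sum_(i < n) x i * z (n - i)%N = \sum_(i < n) y i * z (n - i)%N.
  by apply: eq_bigr => i _; rewrite IH.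
by move/addrI.
Qed.

End FpsRing.

(** * Nonnegative coefficients and formal roots *)

Section FpsNonneg.
Variable R : realFieldType.
Implicit Types x y u : fps R.

Definition fps_ge0 x := forall n, 0 <= x n.

Lemma fps_ge0M x y : fps_ge0 x -> fps_ge0 y -> fps_ge0 (x * y).
Proof. by move=> x0 y0 n; rewrite fps_mulE sumr_ge0// => i _; rewrite mulr_ge0. Qed.

Lemma fps_ge0_mono (a : R) m : 0 <= a -> fps_ge0 (fps_mono a m).
Proof. by move=> a0 n; rewrite /fps_mono; case: ifP. Qed.

(** Uniqueness for a formal differential equation: since [u] has no constant term, degree [n.+1]
    expresses [n.+1%:R * x n.+1] through the coefficients before it. *)
Lemma fps_theta_uniq x y u : u 0%N = 0 -> x 0%N = y 0%N ->
  fps_theta x = x * u -> fps_theta y = y * u -> x = y.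
Proof.
move=> u0 xy0 xu yu; apply/funext => n; elim/ltn_ind: n => -[//|n] IH.
have E z : fps_theta z = z * u ->
    n.+1%:R * z n.+1 = \sum_(i < n.+1) z i * u (n.+1 - i)%N.
  move/(congr1 (fun w : fps R => w n.+1)); rewrite {1}/fps_theta => ->.
  by rewrite fps_mulE big_ord_recr/= subnn u0 mulr0 addr0.
apply: (@mulfI _ n.+1%:R); first by rewrite pnatr_eq0.
by rewrite (E _ xu) (E _ yu); apply: eq_bigr => i _; rewrite IH.
Qed.

(** Here [u] is the logarithmic derivative of [f], and [h] is built from [n theta h = h u],
    [h 0 = 1]. Its recursion only adds, multiplies and divides by positive integers, which keeps [h]
    nonnegative; [h ^+ n] and [f] then solve the same equation with the same constant term. *)
Lemma fps_root_ge0 (f u : fps R) (n : nat) : (0 < n)%N ->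
  f 0%N = 1 -> u 0%N = 0 -> fps_ge0 u -> fps_theta f = f * u ->
  exists h : fps R, [/\ fps_ge0 h, h 0%N = 1 & h ^+ n = f].
Proof.
move=> n0 f0 u0 uge0 fu; have [|h hE] := @fps_strong_rec _
    (fun m h => if m == 0%N then 1 else
       (n%:R * m%:R)^-1 * \sum_(i < m) h i * u (m - i)%N) (0 : R).
  move=> m x y xy; case: eqP => // _; congr (_ * _).
  by apply: eq_bigr => i _; rewrite xy.
have nR0 : n%:R != 0 :> R by rewrite pnatr_eq0 -lt0n.
have h0 : h 0%N = 1 by rewrite hE.
exists h; split => //.
  move=> m; elim/ltn_ind: m => -[|m] IH; rewrite hE//=.
  rewrite mulr_ge0// ?invr_ge0 ?mulr_ge0// sumr_ge0// => i _.
  by rewrite mulr_ge0// IH.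
apply: (fps_theta_uniq u0) fu; first by rewrite fps_exp_coef0 h0 f0 expr1n.
have hu : fps_theta h *+ n = h * u.
  apply/funext => -[|m]; rewrite fps_natmulE.
    by rewrite fps_mul_coef0 u0 mulr0 /fps_theta mul0r mul0rn.
  rewrite fps_mulE big_ord_recr/= subnn u0 mulr0 addr0 /fps_theta {1}hE/=.
  have m0 : m.+1%:R != 0 :> R by rewrite pnatr_eq0.
  rewrite -[LHS]mulr_natr; move: (\sum_(_ < _) _) m.+1%:R n%:R m0 nR0 => s p q p0 q0.
  by field; rewrite q0 p0.
by case: n n0 nR0 hE hu => // n _ _ _ hu; rewrite fps_thetaX -mulrnAr hu mulrA exprSr.
Qed.

End FpsNonneg.

(** * Gauss's ratios of hypergeometric series *)

Section Hypergeometric.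
Variable R : realType.
Implicit Types a b c : R.

Lemma pochhammer0 a : pochhammer a 0%N = 1.
Proof. by rewrite /pochhammer big_ord0. Qed.

Lemma pochhammerS a n : pochhammer a n.+1 = pochhammer a n * (a + n%:R).
Proof. by rewrite /pochhammer big_ord_recr. Qed.

Lemma pochhammerSl a n : pochhammer a n.+1 = a * pochhammer (a + 1) n.
Proof.
rewrite /pochhammer big_ord_recl addr0; congr (_ * _); apply: eq_bigr => i _.
by rewrite lift0 -natr1; ring.
Qed.

Lemma pochhammer_gt0 a n : 0 < a -> 0 < pochhammer a n.
Proof. by move=> a0; apply: prodr_gt0 => i _; rewrite ltr_wpDr. Qed.

Definition hypercoef a b c : fps R :=
  fun k => pochhammer a k * pochhammer b k / (pochhammer c k * k`!%:R).

Lemma hypercoefC a b c : hypercoef a b c = hypercoef b a c.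
Proof. by apply/funext => k; rewrite /hypercoef (mulrC (pochhammer a k)). Qed.

Lemma hypercoef_0 a b c : hypercoef a b c 0%N = 1.
Proof. by rewrite /hypercoef !pochhammer0 fact0 !mulr1 divr1. Qed.

Lemma hypercoef_ge0 a b c : 0 < a -> 0 < b -> 0 < c -> fps_ge0 (hypercoef a b c).
Proof.
move=> a0 b0 c0 n; apply: divr_ge0; apply: mulr_ge0 => //.
all: exact/ltW/pochhammer_gt0.
Qed.

Lemma hypercoefS a b c k : 0 < c -> hypercoef a b c k.+1 =
  (a + k%:R) * (b + k%:R) / ((c + k%:R) * k.+1%:R) * hypercoef a b c k.
Proof.
move=> c0; rewrite /hypercoef !pochhammerS factS natrM -natr1.
have := pochhammer_gt0 k c0; move: (pochhammer c k) => p p0.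
have : 0 < k`!%:R :> R by rewrite ltr0n fact_gt0.
move: k`!%:R => q q0; have k0 : 0 <= k%:R :> R by [].
by field; do !(apply/andP; split); apply: lt0r_neq0 => //; lra.
Qed.

(* Gauss's contiguous relation, whose iteration gives the continued fraction of
   the ratio of the two series on the left *)
Lemma hypercoef_contiguous a b c : 0 < c ->
  hypercoef a (b + 1) (c + 1) - hypercoef a b c =
  fps_mono (a * (c - b) / (c * (c + 1))) 1 * hypercoef (a + 1) (b + 1) (c + 1 + 1).
Proof.
move=> c0; apply/funext => -[|k].
  by rewrite fps_mono_mulE/= fps_addE fps_oppE !hypercoef_0 subrr.
rewrite fps_mono_mulE/= subn1/= fps_addE fps_oppE /hypercoef.
rewrite (pochhammerSl a) (pochhammerS (b + 1)) (pochhammerSl b).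
rewrite (pochhammerSl c) (pochhammerSl (c + 1)) factS natrM.
have := pochhammerS (c + 1) k; rewrite pochhammerSl.
have k0 : 0 <= k%:R :> R by [].
have ck : c + 1 + k%:R != 0 by apply: lt0r_neq0; lra.
move=> /esym/(canRL (mulfK ck)) ->; rewrite -natr1.
have : 0 < pochhammer (c + 1 + 1) k by apply: pochhammer_gt0; lra.
move: (pochhammer _ k) => p p0.
have : 0 < k`!%:R :> R by rewrite ltr0n fact_gt0.
move: k`!%:R => q q0.
by field; do !(apply/andP; split); apply: lt0r_neq0 => //; lra.
Qed.

(** Brings the raised series back to Gauss's ratios: the right-hand series divided by the first one
    on the left falls under [hypercoef_ratio_ge0] with [a + 1] in place of [a]. *)
Lemma hypercoef_raise a b c : 0 < c ->
  hypercoef (a + 1) b c - hypercoef a b c =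
  fps_mono (b / c) 1 * hypercoef (a + 1) (b + 1) (c + 1).
Proof.
move=> c0; apply/funext => -[|k].
  by rewrite fps_mono_mulE/= fps_addE fps_oppE !hypercoef_0 subrr.
rewrite fps_mono_mulE/= subn1/= fps_addE fps_oppE /hypercoef.
rewrite (pochhammerS (a + 1)) (pochhammerSl a) (pochhammerSl b).
rewrite (pochhammerSl c) factS natrM -natr1.
have k0 : 0 <= k%:R :> R by [].
have : 0 < pochhammer (c + 1) k by apply: pochhammer_gt0; lra.
move: (pochhammer (c + 1) k) => p p0.
have : 0 < k`!%:R :> R by rewrite ltr0n fact_gt0.
move: k`!%:R => q q0.
by field; do !(apply/andP; split); apply: lt0r_neq0 => //; lra.
Qed.

(** Both sides rest on [(a)_k (a + k) = a (a + 1)_k]; the monomial of degree 0 is the constant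
    [a]. *)
Lemma theta_hypercoef a b c : 0 < c ->
  fps_theta (hypercoef a b c) = fps_mono a 0%N * (hypercoef (a + 1) b c - hypercoef a b c).
Proof.
move=> c0; apply/funext => k.
rewrite fps_mono_mulE/= subn0 /fps_theta fps_addE fps_oppE /hypercoef.
have := pochhammerS a k; rewrite pochhammerSl => /(congr1 (fun z => z * pochhammer b k)) e.
rewrite -mulrBl [RHS]mulrA [LHS]mulrA; congr (_ * _).
by rewrite mulrBr [a * (pochhammer (a + 1) k * _)]mulrA e; ring.
Qed.

(** The next ratio [r] belongs to the parameters [(b + 1, a, c + 1)], which satisfy the same
    conditions: [a <= c + 1] becomes the first inequality and [b <= c] implies the second. Hence the
    induction on the degree runs over all parameters simultaneously. *)
Lemma hypercoef_ratio_ge0 a b c (q : fps R) :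
  0 < a -> 0 < b + 1 -> b <= c -> a <= c + 1 -> 0 < c ->
  q * hypercoef a b c = hypercoef a (b + 1) (c + 1) -> fps_ge0 q.
Proof.
move=> a0 b0 bc ac c0 qE n; elim/ltn_ind: n a b c q a0 b0 bc ac c0 qE.
move=> n IH a b c q a0 b0 bc ac c0 qE.
have c1 : 0 < c + 1 by rewrite ltr_wpDr.
have [r rE] := fps_div (hypercoef (b + 1) (a + 1) (c + 1 + 1))
  (hypercoef_0 (b + 1) a (c + 1)).
have : q = 1 + fps_mono (a * (c - b) / (c * (c + 1))) 1 * (r * q).
  apply: (fps_mulI (hypercoef_0 a b c)).
  have : q * hypercoef a b c = hypercoef a b c +
      (hypercoef a (b + 1) (c + 1) - hypercoef a b c) by rewrite qE; ring.
  rewrite hypercoef_contiguous// (hypercoefC (a + 1)) -rE (hypercoefC _ a) -qE => ->.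
  by ring.
case: n IH => [|n] IH E.
  by rewrite E fps_addE fps_mono_mulE fps_oneE addr0 ler01.
rewrite E fps_addE fps_mono_mulE fps_oneE add0r subn1/= mulr_ge0//.
  by rewrite divr_ge0 ?mulr_ge0 ?subr_ge0// ltW.
rewrite fps_mulE sumr_ge0// => i _; rewrite mulr_ge0//.
  apply: (IH i _ (b + 1) a (c + 1) r) => //; first by rewrite ltr_wpDr.
  by rewrite lerD2r (le_trans bc)// ltW// ltrDl.
by apply: (IH _ _ a b c q) => //; rewrite ltnS leq_subr.
Qed.

Lemma hypercoef_root_ge0 a b c n : (0 < n)%N ->
  0 < a -> 0 < b -> a <= c -> b <= c ->
  exists h : fps R, [/\ fps_ge0 h, h 0%N = 1 & h ^+ n = hypercoef a b c].
Proof.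
move=> n0 a0 b0 ac bc; have c0 := lt_le_trans a0 ac.
have [r rE] := fps_div (hypercoef (a + 1) (b + 1) (c + 1)) (hypercoef_0 (a + 1) b c).
have r0 : fps_ge0 r.
  by apply: (hypercoef_ratio_ge0 _ _ _ _ _ rE) => //; rewrite ?ltr_wpDr ?lerD2r.
have [s sE] := fps_div (hypercoef (a + 1) b c) (hypercoef_0 a b c).
have sr : s = 1 + fps_mono (b / c) 1 * (r * s).
  apply: (fps_mulI (hypercoef_0 a b c)).
  have : s * hypercoef a b c = hypercoef a b c +
      (hypercoef (a + 1) b c - hypercoef a b c) by rewrite sE; ring.
  by rewrite hypercoef_raise// -rE -sE => ->; ring.
(* By [sr], [s - 1] is [(b / c) z r s], so it is enough to know that [s] is nonnegative, again by
   induction on the degree. *)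
have s0 : fps_ge0 (s - 1).
  have sge : fps_ge0 s.
    move=> m; elim/ltn_ind: m => m IH; rewrite sr fps_addE fps_mono_mulE fps_oneE.
    case: m IH => [|m] IH; first by rewrite addr0 ler01.
    rewrite add0r subn1/= mulr_ge0//.
      by rewrite divr_ge0 ?ltW.
    rewrite fps_mulE sumr_ge0// => i _; rewrite mulr_ge0//.
    by rewrite IH// ltnS leq_subr.
  rewrite (_ : s - 1 = fps_mono (b / c) 1 * (r * s)); last by rewrite {1}sr; ring.
  apply: fps_ge0M; first by apply: fps_ge0_mono; rewrite divr_ge0 ?ltW.
  exact: fps_ge0M.
(* The series [a (s - 1)] is the logarithmic derivative [theta F / F]. *)
apply: (@fps_root_ge0 _ _ (fps_mono a 0%N * (s - 1)) n n0) => //.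
- exact: hypercoef_0.
- rewrite fps_mul_coef0 fps_addE fps_oppE.
  have := congr1 (fun w : fps R => w 0%N) sE.
  by rewrite /= fps_mul_coef0 !hypercoef_0 mulr1 => ->; rewrite subrr mulr0.
- by apply: fps_ge0M => //; apply: fps_ge0_mono; exact: ltW.
- by rewrite theta_hypercoef// -sE; ring.
Qed.

End Hypergeometric.

(** * The gamma function *)

Section IntegralHalfLine.
Variable R : realType.
Local Notation mu := (@lebesgue_measure R).

Lemma bigcup_itv_cbnd_0y (e : R^nat) : (forall n, 0 < e n) ->
  e n @[n --> \oo] --> 0 -> \bigcup_n `[e n, +oo[%classic = `]0, +oo[%classic.
Proof.
move=> e0 ecvg; apply/seteqP; split => x /=.
  by move=> [n _] /=; rewrite !in_itv/= !andbT; exact: lt_le_trans.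
rewrite in_itv/= andbT => x0.
have [N _ /(_ N (leqnn N)) eN] : \forall n \near \oo, e n < x.
  by apply: cvgr_lt ecvg _ _.
by exists N => //=; rewrite in_itv/= andbT ltW.
Qed.

Lemma ge0_integral_0y_cvg (f : R -> \bar R) (e : R^nat) :
  measurable_fun (`]0, +oo[%classic : set R) f -> (forall x, 0 < x -> (0 <= f x)%E) ->
  nonincreasing_seq e -> (forall n, 0 < e n) -> e n @[n --> \oo] --> 0 ->
  (\int[mu]_(x in `[e n, +oo[) f x)%E @[n --> \oo] -->
  (\int[mu]_(x in `]0%R, +oo[) f x)%E.
Proof.
move=> mf f0 edec e0 ecvg; rewrite -(bigcup_itv_cbnd_0y e0 ecvg).
apply: ge0_nondecreasing_set_cvg_integral => //.
- move=> m n mn; apply/subsetPset => x /=; rewrite !in_itv/= !andbT.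
  by apply: le_trans; exact: edec.
- move=> n; apply: measurable_funS mf => // x /=.
  by rewrite !in_itv/= !andbT; exact: lt_le_trans.
- by move=> n x /=; rewrite in_itv/= andbT => enx; rewrite f0// (lt_le_trans (e0 n)).
Qed.

Lemma measurable_fun_0y (f : R -> R) :
  (forall x, 0 < x -> {for x, continuous f}) -> measurable_fun (`]0, +oo[%classic : set R) f.
Proof.
move=> cf; apply: open_continuous_measurable_fun => // x.
by rewrite inE/= in_itv/= andbT; exact: cf.
Qed.

(** The integrand may be unbounded near 0, so the fundamental theorem is applied on the half-lines
    from [1 / (n + 1)], which exhaust []0, +oo[] monotonically. *)
Lemma ge0_FTC_0y (f F : R -> R) (l L : R) :
  (forall x, 0 < x -> 0 <= f x) ->
  (forall x, 0 < x -> {for x, continuous f}) ->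
  (forall x : R, 0 < x -> is_derive x 1 F (f x)) ->
  F x @[x --> 0^'+] --> l -> F x @[x --> +oo] --> L ->
  (\int[mu]_(x in `]0%R, +oo[) (f x)%:E = (L - l)%:E)%E.
Proof.
move=> f0 cf dF Fl FL.
pose e n : R := n.+1%:R^-1.
have e0 n : 0 < e n by rewrite invr_gt0.
have ecvg : e n @[n --> \oo] --> 0 by exact: cvg_harmonic.
have mf : measurable_fun (`]0, +oo[%classic : set R) (EFin \o f).
  by apply/measurable_EFinP; exact: measurable_fun_0y.
have cF x : 0 < x -> {for x, continuous F}.
  move=> x0; apply: differentiable_continuous; apply/derivable1_diffP.
  by have [] := dF x x0.
have step n : (\int[mu]_(x in `[e n, +oo[) (f x)%:E = L%:E - (F (e n))%:E)%E.
  have enx x : e n <= x -> 0 < x by exact: lt_le_trans.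
  apply: ge0_continuous_FTC2y => //.
  - by move=> x /enx; exact: f0.
  - apply/continuous_within_itvcyP; split.
      by move=> x; rewrite in_itv/= andbT => /ltW/enx; exact: cf.
    by apply: cvg_at_right_filter; exact: cf.
  - by move=> x /ltW/enx/dF[].
  - by apply: cvg_at_right_filter; exact: cF.
  - by move=> x; rewrite in_itv/= andbT => /ltW/enx/dF[_ <-]; rewrite derive1E.
have Fe : F (e n) @[n --> \oo] --> l.
  move/cvg_at_rightP : Fl; apply; split => //.
have lim1 : (L - F (e n))%:E @[n --> \oo] --> (L - l)%:E.
  by apply: cvg_EFin; [exact: nearW|apply: cvgB => //; exact: cvg_cst].
have lim2 : (\int[mu]_(x in `[e n, +oo[) (f x)%:E)%E @[n --> \oo] -->
    (\int[mu]_(x in `]0%R, +oo[) (f x)%:E)%E.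
  have edec : nonincreasing_seq e.
    by move=> m n mn; rewrite lef_pV2 ?posrE// ler_nat.
  have fe0 x : 0 < x -> (0 <= (EFin \o f) x)%E by move=> x0; rewrite lee_fin f0.
  exact: (ge0_integral_0y_cvg mf fe0 edec e0 ecvg).
apply: cvg_unique lim2 _ => //.
rewrite (_ : (fun n => _) = (fun n => (L - F (e n))%:E))//.
by apply/funext => n; rewrite step.
Qed.

End IntegralHalfLine.

(** * Finiteness and functional equation of Euler's integral *)

Section GammaIntegral.
Variable R : realType.
Local Notation mu := (@lebesgue_measure R).
Implicit Types x y b t : R.

Lemma expRN_le_powR y : 0 < y ->
  exists2 C : R, 0 < C & forall t, 0 < t -> expR (- t) <= C * (1 + t) `^ (- y).
Proof.
move=> y0; exists (expR (1 - y + y * ln y)); first exact: expR_gt0.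
move=> t t0; have t1 : 0 < 1 + t by rewrite addr_gt0.
rewrite /powR gt_eqF// -expRD ler_expR.
have : ln ((1 + t) / y) <= (1 + t) / y - 1.
  rewrite {1}(_ : (1 + t) / y = 1 + ((1 + t) / y - 1)); last by ring.
  by apply: le_ln1Dx; rewrite ltrBrDl subrr divr_gt0.
rewrite ln_div ?posrE// => /(ler_wpM2l (ltW y0)).
by rewrite !mulrBr mulr1 mulrCA divff ?gt_eqF// mulr1; lra.
Qed.

(** [w] increases from 0 to 1, so for [x > 0] the derivative [p x] of [w^x] has integral 1; up to a
    constant it dominates the gamma integrand. *)
Let w t : R := t / (1 + t).

Let w_gt0 t : 0 < t -> 0 < w t.
Proof. by move=> t0; rewrite /w divr_gt0// addr_gt0. Qed.

Let is_derive_w t : 0 < t -> is_derive t 1 w ((1 + t) ^- 2).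
Proof.
move=> t0; have t1 : 1 + t != 0 by rewrite gt_eqF// addr_gt0.
apply: is_derive_eq; rewrite /GRing.scale/=; field; exact: t1.
Qed.

Let w_le1 t : 0 < t -> w t <= 1.
Proof. by move=> t0; rewrite ler_pdivrMr ?addr_gt0// mul1r lerDr. Qed.

Let w_le t : 0 < t -> w t <= t.
Proof. by move=> t0; rewrite ler_pdivrMr ?addr_gt0// ler_pMr// lerDl ltW. Qed.

Let powRw t y : 0 < t -> w t `^ y * (1 + t) `^ y = t `^ y.
Proof.
move=> t0; rewrite -powRM ?ltW ?w_gt0 ?addr_gt0// /w divfK// gt_eqF//.
by rewrite addr_gt0.
Qed.

Let cvg_inv1Dx : (1 + t)^-1 @[t --> +oo] --> (0 : R).
Proof.
apply/gtr0_cvgV0; last exact: cvg_addrl.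
by near=> t; rewrite addr_gt0.
Unshelve. all: by end_near. Qed.

Let is_derive_powRw x t : 0 < t ->
  is_derive t 1 (fun t => w t `^ x) (x * w t `^ (x - 1) * (1 + t) ^- 2).
Proof.
move=> t0; have dw := is_derive_w t0.
have dp := is_derive1_powR x (w_gt0 t0).
exact: (@is_derive1_comp R (fun s => s `^ x) w t _ _ dp dw).
Qed.

Let cvg0_powRw x : 0 < x -> w t `^ x @[t --> 0^'+] --> 0.
Proof.
move=> x0; apply: (squeeze_cvgr _ (cvg_cst 0) (powR_cvg0 x0)).
near=> t; have t0 : 0 < t by near: t; exact: nbhs_right_gt.
by rewrite powR_ge0/= ge0_ler_powR ?nnegrE ?w_le// ?ltW ?w_gt0.
Unshelve. all: by end_near. Qed.

Let cvgy_powRw x : w t `^ x @[t --> +oo] --> (1 : R).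
Proof.
have cw : w t @[t --> +oo] --> (1 : R).
  have : 1 - (1 + t)^-1 @[t --> +oo] --> (1 - 0 : R).
    by apply: cvgB => //; exact: cvg_cst.
  rewrite subr0; apply: cvg_trans; apply: near_eq_cvg; near=> t.
  have t0 : 0 < t by near: t; exact: nbhs_pinfty_gt.
  by rewrite /w; field; rewrite gt_eqF// addr_gt0.
have <- : 1 `^ x = 1 :> R by rewrite powR1.
apply: (@continuous_cvg _ _ _ _ _ w (fun s : R => s `^ x) 1) => //.
apply: differentiable_continuous; apply/derivable1_diffP.
by apply: derivable_powR; rewrite in_itv/= ltr01.
Unshelve. all: by end_near. Qed.

Let cont_powR_expR x t : 0 < t ->
  {for t, continuous (fun t => t `^ x * expR (- t))}.
Proof.
move=> t0; apply: differentiable_continuous; apply/derivable1_diffP.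
by apply: derivableM => //; apply: derivable_powR; rewrite in_itv/= t0.
Qed.

Let is_derive_powR_expR x t : 0 < t ->
  is_derive t 1 (fun t => t `^ x * expR (- t))
    (x * (t `^ (x - 1) * expR (- t)) - t `^ x * expR (- t)).
Proof.
move=> t0; have dp := is_derive1_powR x t0.
by apply: is_derive_eq; rewrite /GRing.scale/=; ring.
Qed.

Definition gammaint x : \bar R :=
  (\int[mu]_(t in `]0%R, +oo[) (t `^ (x - 1) * expR (- t))%:E)%E.

Let p x t : R := x * w t `^ (x - 1) * (1 + t) ^- 2.

Let p_ge0 x t : 0 < x -> 0 < t -> 0 <= p x t.
Proof.
by move=> x0 t0; rewrite !mulr_ge0 ?powR_ge0 ?invr_ge0 ?exprn_ge0 ?addr_ge0// ltW.
Qed.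

Let cont_p x t : 0 < t -> {for t, continuous (p x)}.
Proof.
move=> t0; apply: differentiable_continuous; apply/derivable1_diffP.
have [d _] := is_derive_powRw (x - 1) t0.
apply: derivableM; first by apply: derivableM.
apply: derivableV; first by rewrite expf_neq0// gt_eqF// addr_gt0.
by [].
Qed.

Let gamma_le_p x : 0 < x -> exists2 C : R, 0 < C &
  forall t, 0 < t -> x * (t `^ (x - 1) * expR (- t)) <= C * p x t.
Proof.
move=> x0; have x10 : 0 < x + 1 by rewrite addr_gt0.
(* The exponent [x + 1] is chosen because [t^(x - 1) (1 + t)^(-(x + 1)) = w^(x - 1) (1 +
   t)^(-2)]. *)
have [C C0 CP] := expRN_le_powR x10.
exists C => // t t0; have t1 : 0 < 1 + t by rewrite addr_gt0.
rewrite /p -!mulrA [leRHS]mulrCA ler_pM2l//.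
apply: le_trans (ler_wpM2l (powR_ge0 _ _) (CP t t0)) _.
rewrite mulrCA ler_pM2l// -(powRw (x - 1) t0) -mulrA ler_wpM2l ?powR_ge0//.
rewrite -powRD ?(gt_eqF t1) ?implybT//.
rewrite (_ : x - 1 + - (x + 1) = - 2%:R); last by ring.
by rewrite powR_invn// ltW.
Qed.

Let cvg0_powR_expR x : 0 < x -> t `^ x * expR (- t) @[t --> 0^'+] --> (0 : R).
Proof.
move=> x0; apply: (squeeze_cvgr _ (cvg_cst 0) (powR_cvg0 x0)).
near=> t; have t0 : 0 < t by near: t; exact: nbhs_right_gt.
rewrite mulr_ge0 ?powR_ge0 ?expR_ge0//=.
rewrite ler_piMr ?powR_ge0// -expR0 ler_expR oppr_le0 ltW//.
Unshelve. all: by end_near. Qed.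

Let cvgy_powR_expR x : 0 < x -> t `^ x * expR (- t) @[t --> +oo] --> (0 : R).
Proof.
move=> x0; have x10 : 0 < x + 1 by rewrite addr_gt0.
have [C C0 CP] := expRN_le_powR x10.
have cC : C * (1 + t)^-1 @[t --> +oo] --> (0 : R).
  by rewrite -[X in _ --> X](mulr0 C); apply: cvgM => //; exact: cvg_cst.
apply: (squeeze_cvgr _ (cvg_cst 0) cC).
near=> t; have t0 : 0 < t by near: t; exact: nbhs_pinfty_gt.
have t1 : 0 < 1 + t by rewrite addr_gt0.
rewrite mulr_ge0 ?powR_ge0 ?expR_ge0//=.
apply: le_trans (ler_wpM2l (powR_ge0 _ _) (CP t t0)) _.
rewrite mulrCA ler_pM2l// -(powRw x t0) -mulrA -powRD ?(gt_eqF t1) ?implybT//.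
rewrite (_ : x + - (x + 1) = - 1%:R); last by ring.
rewrite powR_invn ?(ltW t1)// expr1 ler_piMl ?invr_ge0 ?(ltW t1)//.
have <- : 1 `^ x = 1 :> R by rewrite powR1.
by apply: ge0_ler_powR; rewrite ?nnegrE ?w_le1 ?(ltW x0) ?(ltW (w_gt0 t0)).
Unshelve. all: by end_near. Qed.

Let mgamma x : measurable_fun (`]0, +oo[%classic : set R)
  (fun t : R => (t `^ x * expR (- t))%:E).
Proof.
by apply/measurable_EFinP; apply: measurable_fun_0y => t; exact: cont_powR_expR.
Qed.

Lemma gammaint_fin x : 0 < x -> gammaint x \is a fin_num.
Proof.
move=> x0; have [C C0 CP] := gamma_le_p x0.
rewrite ge0_fin_numE; last first.
  by apply: integral_ge0 => t _; rewrite lee_fin mulr_ge0 ?powR_ge0 ?expR_ge0.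
have pint : (\int[mu]_(t in `]0%R, +oo[) (p x t)%:E = (1 - 0)%:E)%E.
  apply: ge0_FTC_0y (cvg0_powRw x0) (cvgy_powRw x).
  - by move=> t; exact: p_ge0.
  - exact: cont_p.
  - exact: is_derive_powRw.
have mp : measurable_fun (`]0, +oo[%classic : set R) (fun t : R => (p x t)%:E).
  by apply/measurable_EFinP; apply: measurable_fun_0y; exact: cont_p.
apply: (@le_lt_trans _ _ (\int[mu]_(t in `]0%R, +oo[) ((C / x)%:E * (p x t)%:E))%E).
  apply: ge0_le_integral => //=.
  - by move=> t _; rewrite lee_fin mulr_ge0 ?powR_ge0 ?expR_ge0.
  - exact: mgamma.
  - exact: measurable_funeM.
  - move=> t; rewrite in_itv/= andbT => t0.
    by rewrite lee_fin mulrAC ler_pdivlMr// mulrC CP.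
rewrite ge0_integralZl//.
- by rewrite pint -EFinM ltry.
- by move=> t /=; rewrite in_itv/= andbT lee_fin => t0; rewrite p_ge0.
- by rewrite lee_fin divr_ge0// ltW.
Qed.

(** Integration by parts with nonnegative integrands only. The derivative [g - f] of [t^x exp(- t)]
    changes sign, so it is subtracted from the majorant [C p]: [q = C p - g + f] is nonnegative with
    an explicit primitive. Integrating [q + g = C p + f] and cancelling the finite mass [C] gives
    the claim. *)
Lemma gammaintS x : 0 < x -> gammaint (x + 1) = (x%:E * gammaint x)%E.
Proof.
move=> x0; have [C C0 CP] := gamma_le_p x0.
pose g t := x * (t `^ (x - 1) * expR (- t)).
pose f t := t `^ x * expR (- t).
have f0 t : 0 <= f t by rewrite mulr_ge0 ?powR_ge0 ?expR_ge0.
have g0 t : 0 <= g t by rewrite mulr_ge0 ?mulr_ge0 ?powR_ge0 ?expR_ge0 ?ltW.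
have cg t : 0 < t -> {for t, continuous g}.
  by move=> t0; apply: continuousM; [exact: cvg_cst|exact: cont_powR_expR].
have cp t : 0 < t -> {for t, continuous (fun t => C * p x t)}.
  by move=> t0; apply: continuousM; [exact: cvg_cst|exact: cont_p].
pose q t := C * p x t - g t + f t.
have cq t : 0 < t -> {for t, continuous q}.
  move=> t0; apply: continuousD; last exact: cont_powR_expR.
  by apply: continuousB; [exact: cp|exact: cg].
have q0 t : 0 < t -> 0 <= q t.
  by move=> t0; rewrite addr_ge0// subr_ge0 CP.
have mE (h : R -> R) : (forall t, 0 < t -> {for t, continuous h}) ->
    measurable_fun (`]0, +oo[%classic : set R) (fun t => (h t)%:E).
  by move=> ch; apply/measurable_EFinP; exact: measurable_fun_0y.
have pint : (\int[mu]_(t in `]0%R, +oo[) (C * p x t)%:E = (C * 1 - C * 0)%:E)%E.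
  apply: (@ge0_FTC_0y _ _ (fun t => C * w t `^ x)).
  - by move=> t t0; rewrite mulr_ge0 ?p_ge0// ltW.
  - exact: cp.
  - by move=> t t0; exact: (is_deriveZ C (is_derive_powRw x t0)).
  - by apply: cvgMl_tmp; exact: cvg0_powRw.
  - by apply: cvgMl_tmp; exact: cvgy_powRw.
have qint : (\int[mu]_(t in `]0%R, +oo[) (q t)%:E = (C * 1 - 0 - (C * 0 - 0))%:E)%E.
  apply: (@ge0_FTC_0y _ _ (fun t => C * w t `^ x - t `^ x * expR (- t))).
  - exact: q0.
  - exact: cq.
  - move=> t t0; rewrite (_ : q t = C * p x t - (g t - f t)); last by rewrite /q; ring.
    exact: (is_deriveB (is_deriveZ C (is_derive_powRw x t0)) (is_derive_powR_expR x t0)).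
  - apply: cvgB; last exact: cvg0_powR_expR.
    by apply: cvgMl_tmp; exact: cvg0_powRw.
  - apply: cvgB; last exact: cvgy_powR_expR.
    by apply: cvgMl_tmp; exact: cvgy_powRw.
have gE : (\int[mu]_(t in `]0%R, +oo[) (g t)%:E = x%:E * gammaint x)%E.
  rewrite /g /gammaint; under eq_integral do rewrite EFinM.
  rewrite ge0_integralZl//.
  - exact: mgamma.
  - by move=> t _; rewrite lee_fin mulr_ge0 ?powR_ge0 ?expR_ge0.
  - by rewrite lee_fin ltW.
have fE : (\int[mu]_(t in `]0%R, +oo[) (f t)%:E = gammaint (x + 1))%E.
  by rewrite /gammaint addrK.
have : (\int[mu]_(t in `]0%R, +oo[) ((q t)%:E + (g t)%:E) =
        \int[mu]_(t in `]0%R, +oo[) ((C * p x t)%:E + (f t)%:E))%E.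
  by apply: eq_integral => t _; rewrite -!EFinD /q; congr EFin; ring.
rewrite ge0_integralD//; last 4 first.
- by move=> t /=; rewrite in_itv/= andbT lee_fin; exact: q0.
- exact: mE.
- by move=> t _; rewrite lee_fin.
- exact: mE.
rewrite ge0_integralD//; last 4 first.
- move=> t /=; rewrite in_itv/= andbT lee_fin => t0.
  by rewrite mulr_ge0 ?p_ge0// ltW.
- exact: mE.
- by move=> t _; rewrite lee_fin.
- by apply: mE => t; exact: cont_powR_expR.
rewrite pint qint gE fE !(mulr0, subr0) mulr1 => /esym.
have x10 : 0 < x + 1 by rewrite addr_gt0.
rewrite -(fineK (gammaint_fin x0)) -(fineK (gammaint_fin x10)) -EFinM -!EFinD.
by move=> [] /addrI ->.
Qed.

Lemma EFin_Gamma x : 0 < x -> (Gamma x)%:E = gammaint x.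
Proof. by move=> x0; rewrite /Gamma /Rintegral fineK// gammaint_fin. Qed.

Lemma GammaS x : 0 < x -> Gamma (x + 1) = x * Gamma x.
Proof.
move=> x0; apply: EFin_inj; rewrite EFinM !EFin_Gamma ?gammaintS//.
by rewrite addr_gt0.
Qed.

End GammaIntegral.

(** * Positivity of [Gamma] and gamma integrals of arbitrary rate *)

Section GammaFunction.
Variable R : realType.
Local Notation mu := (@lebesgue_measure R).
Implicit Types x b t : R.

Lemma continuous_powR_expR x b t : 0 < t ->
  {for t, continuous (fun t => t `^ x * expR (- (b * t)))}.
Proof.
move=> t0; apply: differentiable_continuous; apply/derivable1_diffP.
by apply: derivableM => //; apply: derivable_powR; rewrite in_itv/= t0.
Qed.

Lemma measurable_powR_expR x b : measurable_fun (`]0, +oo[%classic : set R)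
  (fun t : R => (t `^ x * expR (- (b * t)))%:E).
Proof.
by apply/measurable_EFinP; apply: measurable_fun_0y => t; exact: continuous_powR_expR.
Qed.

Lemma Gamma_gt0 x : 0 < x -> 0 < Gamma x.
Proof.
move=> x0; suff : 0 < x * Gamma x by rewrite pmulr_rgt0.
(* At [x + 1] the exponent of [t] is [x > 0], so on [[1, +oo[] the integrand is at least
   [exp(- t)]. *)
rewrite -GammaS// -lte_fin EFin_Gamma ?addr_gt0// /gammaint addrK.
have cexp : continuous (fun t : R => expR (- t)).
  by move=> t; apply: differentiable_continuous; exact/derivable1_diffP.
have e1 : (\int[mu]_(t in `[1%R, +oo[) (expR (- t))%:E = (0 - (- expR (- 1)))%:E)%E.
  apply: (@ge0_continuous_FTC2y _ _ (fun t => - expR (- t))).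
  - by move=> t _; exact: expR_ge0.
  - exact: continuous_subspaceT.
  - by rewrite -oppr0; apply: cvgN; exact: cvgr_expR.
  - by move=> t _; apply: ex_derive.
  - by apply: cvg_at_right_filter; apply: cvgN; exact: cexp.
  - move=> t _; rewrite derive1E; apply: derive_val; apply: is_derive_eq.
    by rewrite /GRing.scale/=; ring.
have mexp (D : set R) : measurable D -> measurable_fun D (fun t : R => (expR (- t))%:E).
  move=> mD; apply/measurable_EFinP; apply: measurable_funTS.
  exact: continuous_measurable_fun.
have mG : measurable_fun (`]0, +oo[%classic : set R) (fun t : R => (t `^ x * expR (- t))%:E).
  rewrite (_ : (fun t => _) = (fun t => (t `^ x * expR (- (1 * t)))%:E)).
    exact: measurable_powR_expR.
  by apply/funext => t; rewrite mul1r.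
apply: (@lt_le_trans _ _ (\int[mu]_(t in `[1%R, +oo[) (expR (- t))%:E)%E).
  by rewrite e1 sub0r opprK lte_fin expR_gt0.
apply: (@le_trans _ _ (\int[mu]_(t in `[1%R, +oo[) (t `^ x * expR (- t))%:E)%E).
  apply: ge0_le_integral => //=.
  - exact: mexp.
  - apply: measurable_funS mG => // t /=; rewrite !in_itv/= !andbT.
    exact: lt_le_trans.
  - move=> t; rewrite in_itv/= andbT => t1; rewrite lee_fin ler_peMl ?expR_ge0//.
    have x1 : 1 = 1 `^ x :> R by rewrite powR1.
    by rewrite [leLHS]x1 ge0_ler_powR ?(ltW x0) ?nnegrE ?(le_trans ler01 t1).
apply: ge0_subset_integral => //=.
- by move=> t _; rewrite lee_fin mulr_ge0 ?powR_ge0 ?expR_ge0.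
- by move=> t /=; rewrite !in_itv/= !andbT; exact: lt_le_trans.
Qed.

Lemma Gamma_addn x n : 0 < x -> Gamma (x + n%:R) = pochhammer x n * Gamma x.
Proof.
move=> x0; elim: n => [|n IH]; first by rewrite addr0 pochhammer0 mul1r.
rewrite -natr1 addrA GammaS ?ltr_wpDr// IH pochhammerS; ring.
Qed.

Lemma integral_powR_expR x b : 0 < x -> 0 < b ->
  (\int[mu]_(t in `]0%R, +oo[) (t `^ (x - 1) * expR (- (b * t)))%:E =
   (Gamma x * b `^ (- x))%:E)%E.
Proof.
move=> x0 b0.
pose G t := t `^ (x - 1) * expR (- t).
have cG t : 0 < t -> {for t, continuous G}.
  rewrite /G (_ : (fun t => _) = (fun t => t `^ (x - 1) * expR (- (1 * t)))).
    exact: continuous_powR_expR.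
  by apply/funext => s; rewrite mul1r.
have G0 t : 0 <= G t by rewrite mulr_ge0 ?powR_ge0 ?expR_ge0.
pose F t := b * t.
have F'E : derive1 F = cst b.
  apply/funext => t; rewrite derive1E; apply: derive_val; apply: is_derive_eq.
  by rewrite /GRing.scale/=; ring.
have dF t : derivable F t 1 by apply: derivableM.
have cF : continuous F.
  by move=> t; apply: differentiable_continuous; exact/derivable1_diffP.
pose e n : R := n.+1%:R^-1.
have e0 n : 0 < e n by rewrite invr_gt0.
have ecvg : e n @[n --> \oo] --> 0 by exact: cvg_harmonic.
have edec : nonincreasing_seq e.
  by move=> m n mn; rewrite lef_pV2 ?posrE// ler_nat.
(* The substitution [t -> b t] is made away from 0, where the integrand is continuous up to the
   endpoint; both sides then pass to the limit. *)
have sub n : (\int[mu]_(t in `[(b * e n)%R, +oo[) (G t)%:E =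
    \int[mu]_(t in `[e n, +oo[) (b * G (b * t))%:E)%E.
  rewrite -/(F (e n)) increasing_ge0_integration_by_substitutiony.
  - by apply: eq_integral => t _; rewrite F'E /= mulrC.
  - by move=> s t _ _ st; rewrite /F ltr_pM2l.
  - by move=> t _; rewrite F'E; exact: cvg_cst.
  - by rewrite F'E; exact: is_cvg_cst.
  - by rewrite F'E; exact: is_cvg_cst.
  - by split=> [t _|]; [exact: dF|apply: cvg_at_right_filter; exact: cF].
  - exact: gt0_cvgMry.
  - have Fe0 : 0 < F (e n) by rewrite mulr_gt0.
    apply/continuous_within_itvcyP; split.
      by move=> t; rewrite in_itv/= andbT => /(lt_trans Fe0); exact: cG.
    by apply: cvg_at_right_filter; exact: cG.
  - by move=> t _; exact: G0.
have cGb t : 0 < t -> {for t, continuous (fun t => b * G (b * t))}.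
  move=> t0; apply: continuousM; first exact: cvg_cst.
  apply: continuous_comp; first exact: cF.
  by apply: cG; rewrite mulr_gt0.
have l1 : (\int[mu]_(t in `[(b * e n)%R, +oo[) (G t)%:E)%E @[n --> \oo] -->
    (\int[mu]_(t in `]0%R, +oo[) (G t)%:E)%E.
  apply: (@ge0_integral_0y_cvg _ (EFin \o G) (fun n => b * e n)).
  - by apply/measurable_EFinP; exact: measurable_fun_0y.
  - by move=> t _; rewrite lee_fin.
  - by move=> m n mn; rewrite ler_pM2l// edec.
  - by move=> n; rewrite mulr_gt0.
  - by rewrite -[X in _ --> X](mulr0 b); apply: cvgMl_tmp.
have l2 : (\int[mu]_(t in `[e n, +oo[) (b * G (b * t))%:E)%E @[n --> \oo] -->
    (\int[mu]_(t in `]0%R, +oo[) (b * G (b * t))%:E)%E.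
  apply: (@ge0_integral_0y_cvg _ (EFin \o (fun t => b * G (b * t))) e) => //.
  - by apply/measurable_EFinP; exact: measurable_fun_0y.
  - by move=> t _; rewrite lee_fin mulr_ge0// ltW.
have {l1}l1 : (\int[mu]_(t in `[e n, +oo[) (b * G (b * t))%:E)%E @[n --> \oo] -->
    (\int[mu]_(t in `]0%R, +oo[) (G t)%:E)%E.
  by rewrite (_ : (fun n => _) = (fun n => (\int[mu]_(t in `[(b * e n)%R, +oo[) (G t)%:E)%E))//;
    apply/funext => n; rewrite sub.
have : (\int[mu]_(t in `]0%R, +oo[) (G t)%:E =
    \int[mu]_(t in `]0%R, +oo[) (b * G (b * t))%:E)%E.
  by apply: cvg_unique l1 l2.
rewrite -/(gammaint x) -EFin_Gamma// EFinM => ->.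
rewrite muleC -ge0_integralZl//.
- apply: eq_integral => t; rewrite inE/= in_itv/= andbT => t0.
  have bx : (b `^ x)^-1 * (b * b `^ (x - 1)) = 1.
    by rewrite mulr_powRB1 ?ltW// mulVf// gt_eqF// powR_gt0.
  rewrite -EFinM /G powRM ?ltW// powRN; congr EFin.
  rewrite -[LHS]mul1r -{1}bx; ring.
- by apply/measurable_EFinP; exact: measurable_fun_0y.
- by move=> t _; rewrite lee_fin mulr_ge0// ltW.
- by rewrite lee_fin powR_ge0.
Qed.

End GammaFunction.

(** * Sums of nonnegative power series and laws with a density *)

Section SeriesSum.
Variable R : realType.
Implicit Types (u : R^nat) (x y : fps R) (z : R).

Lemma nneseries_EFin u : cvgn (series u) ->
  (\sum_(k <oo) (u k)%:E = (limn (series u))%:E)%E.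
Proof.
move=> cu; rewrite -EFin_lim//; congr (lim (_ @ \oo)).
by apply/funext => n; rewrite /= -sumEFin.
Qed.

Lemma ratio_test u (r : R) (N : nat) : (forall k, 0 <= u k) -> 0 < r < 1 ->
  (forall k, (N <= k)%N -> u k.+1 <= r * u k) -> cvgn (series u).
Proof.
move=> u0 /andP[r0 r1] ur.
(* A sum in place of a maximum: each of the first [N.+1] quotients [u i / r ^+ i] is at most [C]. *)
pose C := \sum_(i < N.+1) u i / r ^+ i.
have uC k : u k <= C * r ^+ k.
  have [kN|Nk] := ltnP k N.+1.
    rewrite -ler_pdivrMr ?exprn_gt0// /C (bigD1 (Ordinal kN))//= lerDl.
    by apply: sumr_ge0 => i _; rewrite divr_ge0 ?exprn_ge0 ?(ltW r0).
  rewrite -(subnKC (ltnW Nk)); elim: (k - N)%N => [|m IH].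
    rewrite addn0 -ler_pdivrMr ?exprn_gt0// /C big_ord_recr/= lerDr.
    by apply: sumr_ge0 => i _; rewrite divr_ge0 ?exprn_ge0 ?(ltW r0).
  rewrite addnS (le_trans (ur _ _)) ?leq_addr// exprS mulrCA.
  by rewrite ler_pM2l.
have C0 k : 0 <= C * r ^+ k by rewrite (le_trans (u0 k)).
apply: (series_le_cvg u0 C0 uC).
by apply: is_cvg_geometric_series; rewrite ger0_norm ?(ltW r0).
Qed.

(** Valued in the extended reals, so that sums can be rearranged before convergence is known. *)
Definition gsum x z : \bar R := (\sum_(k <oo) (x k * z ^+ k)%:E)%E.

Lemma gsum_ge0 x z : fps_ge0 x -> 0 <= z -> (0 <= gsum x z)%E.
Proof.
by move=> x0 z0; apply: nneseries_ge0 => k _ _; rewrite lee_fin mulr_ge0 ?exprn_ge0.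
Qed.

Lemma gsum_ge1 x z : fps_ge0 x -> x 0%N = 1 -> 0 <= z -> (1 <= gsum x z)%E.
Proof.
move=> xge x0 z0.
have := @nneseries_lim_ge R (fun k => (x k * z ^+ k)%:E) xpredT 0 1.
rewrite big_nat1 x0 mul1r expr0; apply => k _.
by rewrite lee_fin mulr_ge0 ?exprn_ge0.
Qed.

Lemma fps_ge0_1 : fps_ge0 (1 : fps R).
Proof. by move=> n; rewrite fps_oneE. Qed.

Lemma gsum1 z : 0 <= z -> gsum 1 z = 1%E.
Proof.
move=> z0; rewrite /gsum (nneseries_split 0 1); last first.
  by move=> k _; rewrite lee_fin mulr_ge0 ?exprn_ge0//; exact: fps_ge0_1.
rewrite add0n big_nat1 mul1r expr0 eseries0 ?adde0// => k k1 _.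
by rewrite fps_oneE gtn_eqF// mul0r.
Qed.

Lemma gsumM x y z : fps_ge0 x -> fps_ge0 y -> 0 <= z ->
  gsum y z \is a fin_num -> gsum (x * y) z = (gsum x z * gsum y z)%E.
Proof.
move=> x0 y0 z0 yfin.
(* Extending the triangle [i <= n] by 0 makes the Cauchy product a double series over the whole
   quadrant, where nonnegative sums may be exchanged. *)
pose a n i : \bar R := if (i <= n)%N then (x i * z ^+ i * (y (n - i)%N * z ^+ (n - i)))%:E else 0%E.
have xz k : 0 <= x k * z ^+ k by rewrite mulr_ge0 ?exprn_ge0.
have yz k : 0 <= y k * z ^+ k by rewrite mulr_ge0 ?exprn_ge0.
have a0 n i : (0 <= a n i)%E by rewrite /a; case: ifP => // _; rewrite lee_fin mulr_ge0.
transitivity (\sum_(n <oo) \sum_(i <oo) a n i)%E.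
  apply: eq_eseriesr => n _; rewrite (nneseries_split 0 n.+1); last by move=> k _; exact: a0.
  rewrite add0n [X in (_ + X)%E]eseries0 ?adde0; last first.
    by move=> k nk _; rewrite /a leqNgt nk.
  rewrite fps_mulE mulr_suml -sumEFin big_mkord; apply: eq_bigr => i _.
  have in' : (i <= n)%N by rewrite -ltnS.
  have -> : z ^+ n = z ^+ i * z ^+ (n - i)%N by rewrite -exprD subnKC.
  by rewrite /a in'; congr EFin; ring.
rewrite nneseries_interchange//.
transitivity (\sum_(i <oo) ((x i * z ^+ i)%:E * gsum y z))%E.
  apply: eq_eseriesr => i _; rewrite /gsum -nneseriesZl; last first.
    by move=> k _; rewrite lee_fin.
  rewrite (nneseries_split 0 i); last by move=> k _; exact: a0.
  rewrite add0n big1_seq ?add0e; last first.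
    move=> k; rewrite mem_index_iota => /andP[_ /andP[_ ki]].
    by rewrite /a leqNgt ki.
  rewrite -nneseries_addn; last by move=> k; exact: a0.
  by apply: eq_eseriesr => k _; rewrite /a leq_addl addnK -EFinM.
rewrite -(fineK yfin) muleC /gsum -nneseriesZl.
  by apply: eq_eseriesr => i _; rewrite muleC.
by move=> k _; rewrite lee_fin.
Qed.

(** The coefficient of degree [k] of [x ^+ n] contains [x k] times a power of the constant term 1,
    and its other contributions are nonnegative. This transfers finiteness from [F] to its root. *)
Lemma gsum_le_exp (x : fps R) n z : (0 < n)%N -> fps_ge0 x -> x 0%N = 1 -> 0 <= z ->
  (gsum x z <= gsum (x ^+ n)%R z)%E.
Proof.
move=> n0 xge x0 z0; apply: lee_nneseries => [k _ _|k _].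
  by rewrite lee_fin mulr_ge0 ?exprn_ge0.
rewrite lee_fin ler_wpM2r ?exprn_ge0//; case: n n0 => // n _.
have xn0 m : fps_ge0 (x ^+ m).
  by elim: m => [|m IH]; [exact: fps_ge0_1|rewrite exprS; exact: fps_ge0M].
rewrite exprS fps_mulE big_ord_recr/= subnn fps_exp_coef0 x0 expr1n mulr1 lerDr.
by apply: sumr_ge0 => i _; rewrite mulr_ge0// xn0.
Qed.

Lemma gsumX (x : fps R) n z : fps_ge0 x -> 0 <= z -> gsum x z \is a fin_num ->
  gsum (x ^+ n) z = (gsum x z ^+ n)%E.
Proof.
move=> x0 z0 xfin.
have xn0 m : fps_ge0 (x ^+ m).
  by elim: m => [|m IH]; [exact: fps_ge0_1|rewrite exprS; exact: fps_ge0M].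
elim: n => [|n IH]; first by rewrite gsum1.
by rewrite exprSr gsumM// IH expeS muleC.
Qed.

End SeriesSum.

(** * Probability laws given by a density *)

Section Density.
Variable R : realType.
Local Notation mu := (@lebesgue_measure R).
Implicit Types g phi : R -> \bar R.

Lemma density_prob g : measurable_fun [set: R] g -> (forall t, (0 <= g t)%E) ->
  (\int[mu]_t g t = 1)%E ->
  exists P : probability (measurableTypeR R) R,
    forall A, measurable A -> P A = (\int[mu]_(t in A) g t)%E.
Proof.
move=> mg g0 g1.
pose m (A : set (measurableTypeR R)) := (\int[mu]_(t in A) g t)%E.
have m0 : m set0 = 0%E by rewrite /m integral_set0.
have m_ge0 A : (0 <= m A)%E by exact: integral_ge0.
have m_sigma : semi_sigma_additive m.
  move=> /= F mF tF mUF; rewrite /m; apply: cvg_toP.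
    apply: ereal_nondecreasing_is_cvgn => i j ij.
    by apply: lee_sum_nneg_natr => // k _ _; exact: integral_ge0.
  by rewrite ge0_integral_bigcup//=; exact: measurable_funTS.
pose M := isMeasure.Build _ _ _ m m0 m_ge0 m_sigma.
pose mM : {measure set (measurableTypeR R) -> \bar R} := HB.pack m M.
have mT : mM setT = 1%E by [].
pose MP := Measure_isProbability.Build _ _ _ mM mT.
pose P : probability (measurableTypeR R) R := HB.pack m M MP.
by exists P.
Qed.

(** The change of variables holds for the Radon-Nikodym derivative of [P], which agrees with [g]
    almost everywhere on [D] because both have the same integral over every measurable subset. *)
Lemma ge0_integral_density (P : probability (measurableTypeR R) R) g phi
    (D : set (measurableTypeR R)) :
  (forall A, measurable A -> P A = (\int[mu]_(t in A) g t)%E) ->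
  measurable_fun [set: R] g -> (forall t, (0 <= g t)%E) -> measurable D ->
  measurable_fun [set: R] phi -> (forall t, (0 <= phi t)%E) ->
  (\int[P]_(t in D) phi t = \int[mu]_(t in D) (phi t * g t))%E.
Proof.
move=> Pg mg g0 mD mphi phi0.
have Pdom : P `<< mu.
  apply/null_content_dominatesP => A mA muA0; rewrite Pg//.
  by apply: null_set_integral => //; exact: measurable_funTS.
rewrite -(Radon_Nikodym_SigmaFinite.change_of_variables Pdom)//; last first.
  exact: measurable_funTS.
have mf : measurable_fun D (Radon_Nikodym_SigmaFinite.f P mu).
  apply: (measurable_funS measurableT) => //.
  exact: measurable_int (Radon_Nikodym_SigmaFinite.f_integrable Pdom).
apply: ae_eq_integral => //.
- by apply: emeasurable_funM => //; exact: measurable_funTS.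
- by apply: emeasurable_funM => //; exact: measurable_funTS.
apply: ae_eqe_mul2l.
apply: integral_ae_eq => //.
- apply: (integrableS measurableT) => //.
  exact: Radon_Nikodym_SigmaFinite.f_integrable.
- exact: measurable_funTS.
- move=> A AD mA; rewrite -Pg//.
  by rewrite -Radon_Nikodym_SigmaFinite.f_integral.
Qed.

End Density.

(** * Mixtures of gamma laws *)

Section GammaMixture.
Variable R : realType.
Local Notation mu := (@lebesgue_measure R).
Variables (h : fps R) (th a : R).
Hypotheses (hge0 : fps_ge0 h) (h0 : h 0%N = 1) (th0 : 0 < th) (a0 : 0 < a).
Implicit Types b s t : R.

(** The weights [h] and the base shape [th] stay free, as two laws are needed: [F] with [mu + nu]
    for the Bessel law, [H] with [(mu + nu) / n] for its root, both with the same [a] and rate. *)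
Definition gmix_term k b t : R :=
  h k * a ^+ (2 * k) / Gamma (th + (2 * k)%:R) *
  (t `^ (th + (2 * k)%:R - 1) * expR (- (b * t))).

(* unnormalised mixture of the gamma laws of shapes [th + 2 k] and rate [b] *)
Definition gmix b t : \bar R := (\sum_(k <oo) (gmix_term k b t)%:E)%E.

(** The total mass of [gmix b]; as a function of the rate it is also the unnormalised Laplace
    transform, by [expR_gmix]. *)
Definition gmix_laplace b : \bar R :=
  ((b `^ (- th))%:E * gsum h ((a / b) ^+ 2))%E.

Let thk0 k : 0 < th + (2 * k)%:R.
Proof. by rewrite ltr_wpDr. Qed.

Let coef_ge0 k : 0 <= h k * a ^+ (2 * k) / Gamma (th + (2 * k)%:R).
Proof. by rewrite divr_ge0 ?mulr_ge0 ?exprn_ge0// ltW// Gamma_gt0. Qed.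

Lemma gmix_term_ge0 k b t : 0 <= gmix_term k b t.
Proof.
by apply: mulr_ge0; [exact: coef_ge0|rewrite mulr_ge0 ?powR_ge0 ?expR_ge0].
Qed.

Lemma gmix_ge0 b t : (0 <= gmix b t)%E.
Proof. by apply: nneseries_ge0 => k _ _; rewrite lee_fin gmix_term_ge0. Qed.

Let measurable_gmix_term k b : measurable_fun (`]0, +oo[%classic : set R)
  (fun t : R => (gmix_term k b t)%:E).
Proof.
apply/measurable_EFinP; apply: measurable_funM; first exact: measurable_cst.
by apply/measurable_EFinP; exact: measurable_powR_expR.
Qed.

Lemma measurable_gmix b : measurable_fun (`]0, +oo[%classic : set R) (gmix b).
Proof.
apply: (@ge0_emeasurable_sum _ _ _ _ (fun k t => (gmix_term k b t)%:E) xpredT).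
  by move=> k t _ _; rewrite lee_fin gmix_term_ge0.
by move=> k _; exact: measurable_gmix_term.
Qed.

Lemma integral_gmix b : 0 < b ->
  (\int[mu]_(t in `]0%R, +oo[) gmix b t = gmix_laplace b)%E.
Proof.
move=> b0; rewrite /gmix integral_nneseries//; last 2 first.
- by move=> k; exact: measurable_gmix_term.
- by move=> k t _; rewrite lee_fin gmix_term_ge0.
rewrite /gmix_laplace /gsum -nneseriesZl; last first.
  by move=> k _; rewrite lee_fin mulr_ge0// !exprn_ge0// divr_ge0// ltW.
apply: eq_eseriesr => k _; rewrite /gmix_term.
under eq_integral do rewrite EFinM.
rewrite ge0_integralZl//; last 3 first.
- exact: measurable_powR_expR.
- by move=> t _; rewrite lee_fin mulr_ge0 ?powR_ge0 ?expR_ge0.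
- by rewrite lee_fin coef_ge0.
(* The gamma factor cancels and leaves [h k * a^(2 k) * b^(-(th + 2 k))]. *)
rewrite integral_powR_expR// -!EFinM; congr EFin.
rewrite opprD powRD ?(gt_eqF b0) ?implybT// powR_invn ?(ltW b0)//.
rewrite -exprM mulnC expr_div_n.
have := Gamma_gt0 (thk0 k); rewrite mulnC.
move: (Gamma _) => G G0; field.
by rewrite expf_neq0 ?gt_eqF.
Qed.

(** Exponential tilting only moves the common rate, so the Laplace transform at [s] is the ratio of
    the masses at rates [b + s] and [b]. *)
Lemma expR_gmix s b t : ((expR (- (s * t)))%:E * gmix b t = gmix (b + s) t)%E.
Proof.
rewrite /gmix -nneseriesZl; last by move=> k _; rewrite lee_fin gmix_term_ge0.
apply: eq_eseriesr => k _; rewrite -EFinM /gmix_term; congr EFin.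
by rewrite mulrDl opprD expRD; ring.
Qed.

Lemma gmix_laplace_gt0 b : 0 < b -> (0 < gmix_laplace b)%E.
Proof.
move=> b0; rewrite mule_gt0 ?lte_fin ?powR_gt0//.
apply: (@lt_le_trans _ _ 1%E) => //; apply: gsum_ge1 => //.
by rewrite exprn_ge0// divr_ge0 ?ltW.
Qed.

Variable b : R.
Hypothesis b0 : 0 < b.
Hypothesis Zfin : gmix_laplace b \is a fin_num.
Let Z := fine (gmix_laplace b).

Let Z0 : 0 < Z.
Proof. by rewrite -lte_fin /Z fineK// gmix_laplace_gt0. Qed.

Definition gmix_pdf : R -> \bar R :=
  (fun t => ((Z^-1)%:E * gmix b t)%E) \_ `]0, +oo[.

Let measurable_gmix_pdf : measurable_fun [set: R] gmix_pdf.
Proof.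
have m : measurable_fun (`]0, +oo[%classic : set R)
    (fun t : R => ((Z^-1)%:E * gmix b t)%E).
  by apply: measurable_funeM; exact: measurable_gmix.
by move/(measurable_restrictT _ (measurable_itv _)) : m.
Qed.

Let gmix_pdf_ge0 t : (0 <= gmix_pdf t)%E.
Proof.
apply: erestrict_ge0 => s _.
by rewrite mule_ge0 ?gmix_ge0// lee_fin invr_ge0 ltW.
Qed.

Let integral_gmix_pdf (D : set R) : measurable D -> `]0, +oo[ `<=` D ->
  (\int[mu]_(t in D) gmix_pdf t = 1)%E.
Proof.
move=> mD sD; rewrite -integral_mkcondr setIC (setIidl sD) ge0_integralZl//.
- by rewrite integral_gmix// -(fineK Zfin) -EFinM mulVf ?gt_eqF.
- exact: measurable_gmix.
- by move=> t _; exact: gmix_ge0.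
- by rewrite lee_fin invr_ge0 ltW.
Qed.

Lemma gmix_prob : exists P : probability (measurableTypeR R) R,
  [/\ forall A, measurable A -> P A = (\int[mu]_(t in A) gmix_pdf t)%E,
      supported_nonneg P &
      forall s, 0 < s -> laplace P s = ((Z^-1)%:E * gmix_laplace (b + s))%E].
Proof.
have [P Pg] := density_prob measurable_gmix_pdf gmix_pdf_ge0
  (integral_gmix_pdf measurableT (@subsetT _ _)).
have s0y : (`]0%R, +oo[%classic : set R) `<=` `[0%R, +oo[%classic.
  by move=> t /=; rewrite !in_itv/= !andbT; exact: ltW.
exists P; split => //.
  by rewrite /supported_nonneg Pg// integral_gmix_pdf.
move=> s s0; rewrite /laplace (ge0_integral_density Pg)//; last first.
- apply/measurable_EFinP; apply: continuous_measurable_fun => t.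
  by apply: differentiable_continuous; exact/derivable1_diffP.
rewrite (_ : (fun t => _) = (fun t => ((Z^-1)%:E * gmix (b + s) t)%E) \_ `]0, +oo[); last first.
  apply/funext => t; rewrite /gmix_pdf !patchE; case: ifPn => _; last by rewrite mule0.
  by rewrite muleCA expR_gmix.
rewrite -integral_mkcondr setIC (setIidl s0y) ge0_integralZl//.
- by rewrite integral_gmix// addr_gt0.
- exact: measurable_gmix.
- by move=> t _; exact: gmix_ge0.
- by rewrite lee_fin invr_ge0 ltW.
Qed.

End GammaMixture.

(** * The Bessel law *)

Section BesselSeries.
Variable R : realType.
Implicit Types a b c z w th : R.

Lemma cvg_hypercoef a b c z : 0 < a -> 0 < b -> b <= c -> 0 <= z < 1 ->
  cvgn (series (fun k => hypercoef a b c k * z ^+ k)).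
Proof.
move=> a0 b0 bc /andP[z0 z1]; have c0 := lt_le_trans b0 bc.
have f0 := hypercoef_ge0 a0 b0 c0.
have z10 : 0 < 1 - z by rewrite subr_gt0.
(* As [b <= c], successive terms have ratio at most [(a + k) z / (k + 1)], which is below
   [(1 + z) / 2] once [2 a <= k (1 - z)]. *)
pose N := (Num.truncn (2 * a / (1 - z))).+1.
have aN : 2 * a <= N%:R * (1 - z).
  by rewrite -ler_pdivrMr//; exact/ltW/truncnS_gt.
apply: (@ratio_test _ _ ((1 + z) / 2) N).
- by move=> k; rewrite mulr_ge0 ?exprn_ge0.
- by apply/andP; split; lra.
move=> k Nk; rewrite hypercoefS// exprS.
have Nk' : N%:R <= k%:R :> R by rewrite ler_nat.
have k0 : 0 <= k%:R :> R by [].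
have aN' : 2 * a <= k%:R * (1 - z) by rewrite (le_trans aN)// ler_pM2r.
rewrite (_ : _ * (z * z ^+ k) = (a + k%:R) * z / k.+1%:R * ((b + k%:R) / (c + k%:R)) *
    (hypercoef a b c k * z ^+ k)); last first.
  rewrite -(natr1 k); field; do !(apply/andP; split); apply: lt0r_neq0; lra.
apply: ler_wpM2r; first by rewrite mulr_ge0 ?exprn_ge0.
apply: (@le_trans _ _ ((a + k%:R) * z / k.+1%:R)).
  rewrite ler_piMr//; first by rewrite !mulr_ge0 ?invr_ge0// addr_ge0// ltW.
  by rewrite ler_pdivrMr ?mul1r ?lerD2r// ltr_wpDr.
rewrite ler_pdivrMr// -(natr1 k).
have az : a * z <= a by rewrite ler_piMr ?ltW.
by lra.
Qed.

Definition bessel_term mu w k : R := (k`!%:R * Gamma (mu + k%:R + 1))^-1 * w ^+ k.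

Lemma bessel_termE mu w k : 0 < mu + 1 -> bessel_term mu w k =
  (k`!%:R * (pochhammer (mu + 1) k * Gamma (mu + 1)))^-1 * w ^+ k.
Proof. by move=> mu1; rewrite /bessel_term addrAC Gamma_addn. Qed.

Lemma bessel_term_ge0 mu w k : 0 < mu + 1 -> 0 <= w -> 0 <= bessel_term mu w k.
Proof.
move=> mu1 w0; rewrite bessel_termE// mulr_ge0 ?exprn_ge0// invr_ge0 mulr_ge0//.
by rewrite mulr_ge0// ltW ?pochhammer_gt0 ?Gamma_gt0.
Qed.

Lemma cvg_bessel_term mu w : 0 < mu + 1 -> 0 <= w ->
  cvgn (series (bessel_term mu w)).
Proof.
move=> mu1 w0.
(* The ratio [w / ((k + 1) (mu + 1 + k))] is at most [1 / 2] once [2 w <= k (mu + 1)]. *)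
pose N := (Num.truncn (2 * w / (mu + 1))).+1.
have wN : 2 * w <= N%:R * (mu + 1).
  by rewrite -ler_pdivrMr//; exact/ltW/truncnS_gt.
apply: (@ratio_test _ _ (1 / 2) N).
- by move=> k; exact: bessel_term_ge0.
- by apply/andP; split; lra.
move=> k Nk.
have Nk' : N%:R <= k%:R :> R by rewrite ler_nat.
have k0 : 0 <= k%:R :> R by [].
have wk : 2 * w <= k%:R * (mu + 1) by rewrite (le_trans wN)// ler_pM2r.
have -> : bessel_term mu w k.+1 =
    w / (k.+1%:R * (mu + 1 + k%:R)) * bessel_term mu w k.
  rewrite !bessel_termE// pochhammerS factS natrM exprS.
  have := pochhammer_gt0 k mu1; have := Gamma_gt0 mu1.
  move: (Gamma _) (pochhammer _ _) => G p G0 p0.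
  have : 0 < k`!%:R :> R by rewrite ltr0n fact_gt0.
  move: k`!%:R (w ^+ k) => q wk' q0; rewrite -(natr1 k).
  by field; do !(apply/andP; split); apply: lt0r_neq0 => //; lra.
apply: ler_wpM2r; first exact: bessel_term_ge0.
rewrite ler_pdivrMr; last by rewrite mulr_gt0// ltr_wpDr.
by rewrite -(natr1 k); nra.
Qed.

(* the duplication formula of the gamma function, read on its increments *)
Lemma pochhammer_double th k : pochhammer th (2 * k) =
  4 ^+ k * (pochhammer (th / 2) k * pochhammer ((th + 1) / 2) k).
Proof.
elim: k => [|k IH]; first by rewrite muln0 !pochhammer0 expr0 !mulr1.
rewrite mulnS !pochhammerS IH exprS -(natr1 (2 * k)) natrM.
by field.
Qed.

End BesselSeries.

(** * The Bessel law as a mixture and its convolution roots *)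

Section BesselLaw.
Variable R : realType.
Variables mu nu a b : R.
Hypotheses (munu0 : 0 < mu + nu) (numu : nu <= mu + 1) (a0 : 0 < a) (ab : a < b).
Let th := mu + nu.
Let f := hypercoef (th / 2) ((th + 1) / 2) (mu + 1).

Let b0 : 0 < b. Proof. exact: lt_trans ab. Qed.
(** Combining the hypotheses, [0 < mu + nu <= 2 mu + 1]. *)
Let mu10 : 0 < mu + 1. Proof. by move: munu0 numu; lra. Qed.

Let fge0 : fps_ge0 f.
Proof. by apply: hypercoef_ge0 => //; rewrite /th; move: munu0 numu; lra. Qed.

Let ratio_lt1 s : b <= s -> 0 <= (a / s) ^+ 2 < 1.
Proof.
move=> bs; have s0 := lt_le_trans b0 bs.
rewrite exprn_ge0 ?divr_ge0 ?(ltW a0) ?(ltW s0)//= expr_lt1//.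
  by rewrite ltr_pdivrMr// mul1r (lt_le_trans ab).
by rewrite divr_ge0 ?(ltW a0) ?(ltW s0).
Qed.

Let cvgf s : b <= s -> cvgn (series (fun k => f k * ((a / s) ^+ 2) ^+ k)).
Proof. by move=> bs; apply: cvg_hypercoef (ratio_lt1 bs); rewrite /th; move: munu0 numu; lra. Qed.

Let gsum_fin s : b <= s -> gsum f ((a / s) ^+ 2) \is a fin_num.
Proof. by move=> bs; rewrite /gsum nneseries_EFin//; exact: cvgf. Qed.

Let Zfin : gmix_laplace f th a b \is a fin_num.
Proof. by rewrite fin_numM// gsum_fin. Qed.

Lemma bessel_pdfE x : (bessel_pdf mu nu a b x)%:E = gmix_pdf f th a b x.
Proof.
rewrite /bessel_pdf /gmix_pdf !patchE; case: ifPn => //.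
rewrite inE/= in_itv/= andbT => x0.
have w0 : 0 <= (a * x / 2) ^+ 2 by rewrite exprn_ge0// divr_ge0// mulr_ge0 ?ltW.
rewrite /besselI mulrA mulrA EFinM.
rewrite -[limn _]/(limn (series (bessel_term mu ((a * x / 2) ^+ 2)))).
rewrite -nneseries_EFin; last exact: cvg_bessel_term.
rewrite -nneseriesZl; last by move=> k _; rewrite lee_fin bessel_term_ge0.
rewrite /gmix -nneseriesZl; last by move=> k _; rewrite lee_fin gmix_term_ge0.
apply: eq_eseriesr => k _; rewrite -!EFinM; congr EFin.
pose S := limn (series (fun k => f k * ((a / b) ^+ 2) ^+ k)).
have ZE : gmix_laplace f th a b = (b `^ (- th) * S)%:E.
  by rewrite /gmix_laplace /gsum nneseries_EFin -?EFinM//; exact: cvgf.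
have S0 : 0 < S.
  have := gmix_laplace_gt0 th fge0 (hypercoef_0 _ _ _) a0 b0.
  by rewrite ZE lte_fin pmulr_rgt0// powR_gt0.
(* So [norm_const] is the mass [b^(-th) S] of the mixture times
   [(a / 2)^mu Gamma(th) / Gamma(mu + 1)]; these factors cancel against the Bessel coefficients. *)
have ncE : norm_const mu nu a b =
    (a / 2) `^ mu * b `^ (- th) * (Gamma th / Gamma (mu + 1)) * S.
  by rewrite /norm_const /hypergeom2F1 -expr_div_n powRN.
rewrite ZE ncE /= bessel_termE// /gmix_term Gamma_addn// pochhammer_double.
rewrite /f /hypercoef.
rewrite (_ : a * x / 2 = a / 2 * x); last by ring.
rewrite (@powRM _ (a / 2) x) ?(ltW x0) ?divr_ge0 ?(ltW a0)//.
rewrite (_ : th + (2 * k)%:R - 1 = mu + (nu - 1) + (2 * k)%:R); last by rewrite /th; ring.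
rewrite !powRD ?(gt_eqF x0) ?implybT// powR_mulrn ?(ltW x0)// !exprM.
(* The denominator 4 matches the [4 ^+ k] produced by [pochhammer_double]. *)
rewrite (_ : (a / 2 * x) ^+ 2 = a ^+ 2 * x ^+ 2 / 4); last by field.
rewrite expr_div_n exprMn.
have q0 : 0 < k`!%:R :> R by rewrite ltr0n fact_gt0.
have c0 := pochhammer_gt0 k mu10.
have p1 : 0 < pochhammer (th / 2) k by apply: pochhammer_gt0; rewrite divr_gt0.
have p2 : 0 < pochhammer ((th + 1) / 2) k.
  by apply: pochhammer_gt0; rewrite divr_gt0// addr_gt0.
field.
by do !(apply/andP; split); rewrite ?expf_neq0// gt_eqF// ?powR_gt0 ?Gamma_gt0 ?divr_gt0.
Qed.

Lemma bessel_law_inf_div : exists P : probability (measurableTypeR R) R,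
  has_density P (bessel_pdf mu nu a b) /\ infinitely_divisible P.
Proof.
have [P [Pd Ps Pl]] := gmix_prob fge0 (hypercoef_0 _ _ _) munu0 a0 b0 Zfin.
exists P; split.
  by move=> A mA; rewrite Pd//; apply: eq_integral => t _; rewrite bessel_pdfE.
split=> // n n0.
have [h [hge0 h0 hf]] : exists h, [/\ fps_ge0 h, h 0%N = 1 & h ^+ n = f].
  (* The larger upper parameter satisfies [(mu + nu + 1) / 2 <= mu + 1] exactly when
     [nu <= mu + 1]. *)
  by apply: hypercoef_root_ge0 => //; rewrite /th; move: munu0 numu; lra.
have nR0 : 0 < n%:R :> R by rewrite ltr0n.
have thn0 : 0 < th / n%:R by rewrite divr_gt0.
have hfin s : b <= s -> gsum h ((a / s) ^+ 2) \is a fin_num.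
  move=> /[dup] bs /ratio_lt1/andP[z0 _].
  have := gsum_le_exp n0 hge0 h0 z0; rewrite hf => le.
  rewrite ge0_fin_numE ?gsum_ge0// (le_lt_trans le)//.
  by rewrite -ge0_fin_numE ?gsum_fin// gsum_ge0.
have Lfin s : b <= s -> gmix_laplace h (th / n%:R) a s \is a fin_num.
  by move=> bs; rewrite fin_numM// hfin.
(* Dividing the shape [th] by [n] makes the prefactor [s^(-th)] an [n]-th power as well. *)
have LX s : b <= s ->
    gmix_laplace f th a s = (gmix_laplace h (th / n%:R) a s ^+ n)%E.
  move=> bs; have /andP[z0 _] := ratio_lt1 bs.
  rewrite /gmix_laplace -hf gsumX ?hfin// -(fineK (hfin s bs)).
  move: (fine _) => g; rewrite -EFinM -!EFin_expe -EFinM exprMn; congr (_ * _)%:E.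
  rewrite -powR_mulrn ?powR_ge0// -powRrM; congr (_ `^ _); field.
  by rewrite gt_eqF.
have [Q [_ Qs Ql]] := gmix_prob hge0 h0 thn0 a0 b0 (Lfin b (lexx b)).
exists Q; split => // s s0.
have bs : b <= b + s by rewrite lerDl ltW.
(* [LX] is used at rate [b + s] for the transform and at rate [b] for the normalisation. *)
rewrite Pl// Ql// !LX//; move: (Lfin _ bs) (Lfin b (lexx b)).
move: (gmix_laplace _ _ _ _) (gmix_laplace _ _ _ _) => u v.
move=> /fineK <- /fineK <-.
rewrite -EFin_expe -EFin_expe /= -[in RHS]EFinM -[in RHS]EFin_expe.
by rewrite -EFinM exprMn exprVn.
Qed.

End BesselLaw.

Unset Implicit Arguments.

Theorem theorem3 (R : realType) (mu nu a b : R)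
    (hmunu : 0 < mu + nu) (hnu : nu <= mu + 1) (ha : 0 < a) (hab : a < b) :
  exists P : probability (measurableTypeR R) R,
    has_density P (bessel_pdf mu nu a b) /\ infinitely_divisible P.
Proof. exact: bessel_law_inf_div. Qed.
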